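(* Let $-\infty<t_1<t_2<+\infty$ and $z\in\mathbb C^{\rm up}$. (1) If $z$ lies outside the closed half-disc with diameter $[t_1,t_2]$, i.e. $\bigl|z-\frac{t_1+t_2}2\bigr|>\frac{t_2-t_1}2$, or equivalently $|z|^2-\operatorname{Re}z\,(t_1+t_2)+t_1t_2>0$, then $$\omega(z,[t_1,t_2])=\frac1\pi\arctan\frac{(t_2-t_1)\operatorname{Im}z}{|z|^2-\operatorname{Re}z\,(t_1+t_2)+t_1t_2}\le\frac1\pi\,\frac{(t_2-t_1)\operatorname{Im}z}{|z|^2-\operatorname{Re}z\,(t_1+t_2)+t_1t_2}.$$ (2) If $z$ lies in the open half-disc with diameter $[t_1,t_2]$, i.e. $\bigl|z-\frac{t_1+t_2}2\bigr|<\frac{t_2-t_1}2$, or equivalently $|z|^2-\operatorname{Re}z\,(t_1+t_2)+t_1t_2<0$, then $$\omega(z,[t_1,t_2])=1+\frac1\pi\arctan\frac{(t_2-t_1)\operatorname{Im}z}{|z|^2-\operatorname{Re}z\,(t_1+t_2)+t_1t_2}\ge1+\frac1\pi\,\frac{(t_2-t_1)\operatorname{Im}z}{|z|^2-\operatorname{Re}z\,(t_1+t_2)+t_1t_2}.$$ (3) If $z$ lies on the half-circle with diameter $[t_1,t_2]$, i.e. $\bigl|z-\frac{t_1+t_2}2\bigr|=\frac{t_2-t_1}2$, or equivalently $|z|^2-\operatorname{Re}z\,(t_1+t_2)+t_1t_2=0$, then $\omega(z,[t_1,t_2])=\frac12$.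
   Context: $\mathbb C^{\rm up}=\{\operatorname{Im}z>0\}$. Harmonic measure of the upper half-plane: $\omega(z,B)=\frac1\pi\int_{B\cap\mathbb R}\frac{\operatorname{Im}z}{(t-\operatorname{Re}z)^2+(\operatorname{Im}z)^2}\,dt$ for $z\in\mathbb C^{\rm up}$ and Borel $B$. *)

(* Defs.v *)
From mathcomp Require Import all_boot all_order all_algebra.
From mathcomp Require Import complex.
From mathcomp Require Import all_classical all_reals all_analysis.

Set Implicit Arguments.
Unset Strict Implicit.
Unset Printing Implicit Defensive.

Import Order.TTheory GRing.Theory Num.Theory.

Local Open Scope classical_set_scope.
Local Open Scope ring_scope.
Local Open Scope complex_scope.

Definition Cup (R : realType) : set R[i] := [set z | 0 < complex.Im z].

(* B is a subset of the complex plane and the integral runs over the set of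
   reals t with t%:C \in B, i.e., over the trace of B on the real line.  The
   value is kept in \bar R, so that no integrability is presupposed. *)
Definition harmonic_measure (R : realType) (z : R[i]) (B : set R[i]) : \bar R :=
  ((pi^-1)%:E *
   \int[lebesgue_measure]_(t in [set t : R | B t%:C])
     (complex.Im z / ((t - complex.Re z) ^+ 2 + complex.Im z ^+ 2))%:E)%E.

Definition segC (R : realType) (t1 t2 : R) : set R[i] :=
  [set t%:C | t in `[t1, t2]].

(* Main.v *)
Require Import Defs.
From mathcomp Require Import all_boot all_order all_algebra.
From mathcomp Require Import ring lra.
From mathcomp Require Import complex.
From mathcomp Require Import all_classical all_reals all_analysis.

Import Order.TTheory GRing.Theory Num.Theory.
Import numFieldNormedType.Exports.
Import Normc.

Local Open Scope classical_set_scope.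
Local Open Scope ring_scope.
Local Open Scope complex_scope.

(* Integrating the Poisson kernel gives pi * omega = atan b - atan a with
   a = (t1 - Re z) / Im z and b = (t2 - Re z) / Im z.  This angle lies in
   ]0, pi[, its tangent is (b - a) / (1 + a b), and its cosine has the sign of
   1 + a b = D / (Im z)^2, where D is the power of z with respect to the circle
   with diameter [t1, t2]; the sign of D thus selects the branch of atan. *)

Lemma cos_atan_gt0 (R : realType) (x : R) : 0 < cos (atan x).
Proof. by apply: cos_gt0_pihalf; rewrite atan_gtNpi2 atan_ltpi2. Qed.

Lemma sin_atan (R : realType) (x : R) : sin (atan x) = x * cos (atan x).
Proof. by rewrite -{2}[x]atanK /tan mulfVK// gt_eqF// cos_atan_gt0. Qed.

(** Both cosines on the right are positive, so [1 + a * b] alone decides on which side of [pi / 2]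
    the angle lies. *)
Lemma cos_atanB (R : realType) (a b : R) :
  cos (atan b - atan a) = cos (atan b) * cos (atan a) * (1 + a * b).
Proof. by rewrite cosB !sin_atan; ring. Qed.

(** At [1 + a * b = 0] both sides are [0]: the cosine of the angle vanishes and the inverse of [0]
    is [0]. *)
Lemma tan_atanB (R : realType) (a b : R) :
  tan (atan b - atan a) = (b - a) / (1 + a * b).
Proof.
rewrite tanD ?cosN ?gt_eqF ?cos_atan_gt0// tanN !atanK.
by congr (_ / _); ring.
Qed.

Lemma atanB_itv (R : realType) (a b : R) : a < b ->
  atan b - atan a \in `]0, pi[.
Proof.
move=> /lt_atan ab; rewrite in_itv/= subr_gt0 ab/=.
have := atan_gtNpi2 a; have := atan_ltpi2 b; lra.
Qed.

Lemma atanB_itvcc (R : realType) (a b : R) : a < b ->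
  atan b - atan a \in `[0, pi].
Proof. by move=> /atanB_itv; apply: subset_itv_oo_cc. Qed.

Lemma pihalf_itvcc (R : realType) : pi / 2 \in `[0, (pi : R)].
Proof. by rewrite in_itv/=; have := pi_gt0 R; lra. Qed.

Lemma atanB_pos (R : realType) (a b : R) : a < b -> 0 < 1 + a * b ->
  atan b - atan a = atan ((b - a) / (1 + a * b)).
Proof.
move=> ab ab1; rewrite -tan_atanB tanK// in_itv/=.
(* Cosine is strictly decreasing on [[0, pi]] and vanishes at [pi / 2], so the bound amounts to
   positivity of the cosine. *)
have lt_pi2 : atan b - atan a < pi / 2.
  rewrite -ltr_cos ?atanB_itvcc ?pihalf_itvcc// cos_pihalf cos_atanB.
  by rewrite !mulr_gt0 ?cos_atan_gt0.
move: (atanB_itv _ a b ab); rewrite lt_pi2 in_itv/=.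
by have := pi_gt0 R; lra.
Qed.

Lemma atanB_neg (R : realType) (a b : R) : a < b -> 1 + a * b < 0 ->
  atan b - atan a = pi + atan ((b - a) / (1 + a * b)).
Proof.
move=> ab ab1; set d := atan b - atan a.
(* The angle lies beyond [pi / 2]; subtracting the period [pi] of [tan] brings it into []-pi/2, 0[],
   where [atan] inverts [tan]. *)
have dE : (b - a) / (1 + a * b) = tan (d - pi).
  by rewrite -[in RHS]tanDpi subrK tan_atanB.
have gt_pi2 : pi / 2 < d.
  rewrite -ltr_cos ?atanB_itvcc ?pihalf_itvcc// cos_pihalf cos_atanB.
  by rewrite nmulr_llt0 ?mulr_gt0 ?cos_atan_gt0.
rewrite dE tanK; first by ring.
move: (atanB_itv _ a b ab); rewrite -/d !in_itv/=; lra.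
Qed.

(** The tangent carries no information here; the angle is recovered from its cosine, which is
    injective on [[0, pi]]. *)
Lemma atanB_zero (R : realType) (a b : R) : a < b -> 1 + a * b = 0 ->
  atan b - atan a = pi / 2.
Proof.
move=> ab ab1; apply: cos_inj; rewrite ?atanB_itvcc ?pihalf_itvcc//.
by rewrite cos_pihalf cos_atanB ab1 mulr0.
Qed.

Lemma atan_le_id (R : realType) (x : R) : 0 <= x -> atan x <= x.
Proof.
move=> x0.
have catan : {within `[0, x], continuous (@atan R)}.
  by apply: continuous_subspaceT => c; exact: continuous_atan.
(* Some [c] gives [atan x = x / (1 + c ^+ 2)], and the denominator is at least [1]. *)
have [c _] := MVT_segment x0 (fun c _ => is_derive1_atan c) catan.
rewrite atan0 !subr0 => ->; apply: ler_piMl => //.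
by rewrite invf_le1 ?ltr_wpDr ?lerDl ?sqr_ge0.
Qed.

Lemma id_le_atan (R : realType) (x : R) : x <= 0 -> x <= atan x.
Proof. by move=> x0; rewrite -lerN2 -atanN atan_le_id// oppr_ge0. Qed.

Lemma is_derive_poisson (R : realType) (x y t : R) : 0 < y ->
  is_derive t 1 (fun t => atan ((t - x) / y)) (y / ((t - x) ^+ 2 + y ^+ 2)).
Proof.
move=> y0.
have dlin : is_derive t 1 (fun t => (t - x) / y) y^-1.
  have -> : (fun t => (t - x) / y) = y^-1 \*: (id - cst x).
    by apply/funext => s; rewrite /= mulrC.
  by apply: is_derive_eq; rewrite subr0 /GRing.scale/= mulr1.
have dcomp := @is_derive1_comp _ (@atan R) _ t _ _ (is_derive1_atan _) dlin.
apply: is_derive_eq; rewrite /GRing.scale/=.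
field; apply/andP; split; last exact: lt0r_neq0.
by rewrite gt_eqF// ltr_wpDl ?sqr_ge0 ?exprn_gt0.
Qed.

Lemma integral_poisson (R : realType) (x y t1 t2 : R) : 0 < y -> t1 < t2 ->
  (\int[lebesgue_measure]_(t in `[t1, t2]) (y / ((t - x) ^+ 2 + y ^+ 2))%:E =
   (atan ((t2 - x) / y) - atan ((t1 - x) / y))%:E)%E.
Proof.
move=> y0 t12; pose F t := atan ((t - x) / y).
have dF t : derivable F t 1 by have [] := is_derive_poisson _ x y t y0.
have cF : continuous F by move=> t; exact/differentiable_continuous/derivable1_diffP.
rewrite (@continuous_FTC2 _ _ F) ?EFinB//.
- apply: continuous_subspaceT => t; apply: cvgM; first exact: cvg_cst.
  apply: cvgV; first by rewrite gt_eqF// ltr_wpDl ?sqr_ge0 ?exprn_gt0.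
  apply: cvgD; last exact: cvg_cst.
  have subx : s - x @[s --> t] --> t - x.
    by apply: cvgB; [exact: cvg_id|exact: cvg_cst].
  exact: (cvgM subx subx).
- split => //; [exact/cvg_at_right_filter/cF|exact/cvg_at_left_filter/cF].
- by move=> t _; rewrite derive1E; have /@derive_val := is_derive_poisson _ x y t y0.
Qed.

Lemma harmonic_measure_segC (R : realType) (t1 t2 : R) (z : R[i]) :
  t1 < t2 -> Cup z -> harmonic_measure z (segC t1 t2) =
    (pi^-1 * (atan ((t2 - complex.Re z) / complex.Im z)
            - atan ((t1 - complex.Re z) / complex.Im z)))%:E.
Proof.
move=> t12 z0; rewrite /harmonic_measure.
(* The embedding of the reals is injective, so the trace of the segment on the real line is the
   interval itself. *)
have -> : [set t : R | segC t1 t2 t%:C] = `[t1, t2]%classic.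
  by apply/seteqP; split => [t [s ? [<-]]//|t t12t]; exists t.
by rewrite integral_poisson// EFinM.
Qed.

(** Completing the square in [Re z]; the sign of this quantity then locates [z] relative to the
    circle. *)
Lemma normc_disc (R : realType) (t1 t2 : R) (z : R[i]) :
  normc z ^+ 2 - complex.Re z * (t1 + t2) + t1 * t2 =
  normc (z - ((t1 + t2) / 2)%:C) ^+ 2 - ((t2 - t1) / 2) ^+ 2.
Proof.
by case: z => x y /=; rewrite !sqr_sqrtr ?addr_ge0 ?sqr_ge0//; field.
Qed.

Theorem mainTheorem8 (R : realType) (t1 t2 : R) (z : R[i])
    (ht : t1 < t2) (hz : Cup z) :
  [/\ ((t2 - t1) / 2 < normc (z - ((t1 + t2) / 2)%:C) <->
         0 < normc z ^+ 2 - complex.Re z * (t1 + t2) + t1 * t2) /\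
      ((t2 - t1) / 2 < normc (z - ((t1 + t2) / 2)%:C) ->
         harmonic_measure z (segC t1 t2) =
           (pi^-1 * atan ((t2 - t1) * complex.Im z /
              (normc z ^+ 2 - complex.Re z * (t1 + t2) + t1 * t2)))%:E /\
         pi^-1 * atan ((t2 - t1) * complex.Im z /
             (normc z ^+ 2 - complex.Re z * (t1 + t2) + t1 * t2)) <=
           pi^-1 * ((t2 - t1) * complex.Im z /
             (normc z ^+ 2 - complex.Re z * (t1 + t2) + t1 * t2))),
      (normc (z - ((t1 + t2) / 2)%:C) < (t2 - t1) / 2 <->
         normc z ^+ 2 - complex.Re z * (t1 + t2) + t1 * t2 < 0) /\
      (normc (z - ((t1 + t2) / 2)%:C) < (t2 - t1) / 2 ->
         harmonic_measure z (segC t1 t2) =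
           (1 + pi^-1 * atan ((t2 - t1) * complex.Im z /
              (normc z ^+ 2 - complex.Re z * (t1 + t2) + t1 * t2)))%:E /\
         1 + pi^-1 * ((t2 - t1) * complex.Im z /
             (normc z ^+ 2 - complex.Re z * (t1 + t2) + t1 * t2)) <=
           1 + pi^-1 * atan ((t2 - t1) * complex.Im z /
             (normc z ^+ 2 - complex.Re z * (t1 + t2) + t1 * t2)))
    & (normc (z - ((t1 + t2) / 2)%:C) = (t2 - t1) / 2 <->
         normc z ^+ 2 - complex.Re z * (t1 + t2) + t1 * t2 = 0) /\
      (normc (z - ((t1 + t2) / 2)%:C) = (t2 - t1) / 2 ->
         harmonic_measure z (segC t1 t2) = (2^-1)%:E)].
Proof.
set D := _ + t1 * t2.
set r := (t2 - t1) / 2; set d := normc _.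
(* As [r] and [d] are nonnegative, comparing them is comparing their squares, which is reading off
   the sign of [D]. *)
have r0 : 0 <= r by rewrite divr_ge0// subr_ge0 ltW.
have d0 : 0 <= d by rewrite /d; case: (z - _) => ? ?; exact: sqrtr_ge0.
have DE : D = d ^+ 2 - r ^+ 2 by exact: normc_disc.
have out : r < d <-> 0 < D by rewrite DE subr_gt0 ltr_sqr.
have inn : d < r <-> D < 0 by rewrite DE subr_lt0 ltr_sqr.
have bnd : d = r <-> D = 0.
  rewrite DE; split=> [->|/eqP]; first by rewrite subrr.
  by rewrite subr_eq0 eqrXn2// => /eqP.
have y0 : 0 < complex.Im z by exact: hz.
have N0 : 0 <= (t2 - t1) * complex.Im z by rewrite mulr_ge0 ?subr_ge0 ?ltW.
rewrite harmonic_measure_segC//.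
set a := (t1 - _) / _; set b := (t2 - _) / _.
have ab : a < b by rewrite ltr_pM2r ?invr_gt0// ltrD2r.
(* With [z = x + iy], expanding [y ^+ 2 + (t1 - x) * (t2 - x)] gives [D]. *)
have Dab : 1 + a * b = D / complex.Im z ^+ 2.
  rewrite /a /b /D; case: (z) y0 => x y /= y0.
  rewrite sqr_sqrtr ?addr_ge0 ?sqr_ge0//; field; exact: lt0r_neq0.
have y2 : 0 < (complex.Im z ^+ 2)^-1 by rewrite invr_gt0 exprn_gt0.
have qE : D != 0 -> (b - a) / (1 + a * b) = (t2 - t1) * complex.Im z / D.
  by rewrite Dab /a /b => D0; field; rewrite D0 lt0r_neq0.
have pi0 : 0 < (pi : R)^-1 by rewrite invr_gt0 pi_gt0.
split; split=> //.
- move=> /out D0; have q := qE (lt0r_neq0 D0).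
  rewrite atanB_pos ?Dab ?mulr_gt0// -Dab q; split=> //.
  by rewrite ler_pM2l// atan_le_id// divr_ge0// ltW.
- move=> /inn D0; have q := qE (ltr0_neq0 D0).
  rewrite atanB_neg ?Dab ?nmulr_rlt0// -Dab q; split.
    by rewrite mulrDr mulVf// gt_eqF// pi_gt0.
  (* Since [D < 0], the argument of [atan] is nonpositive, which reverses the comparison with the
     identity. *)
  by rewrite lerD2l ler_pM2l// id_le_atan// mulr_ge0_le0// invr_le0 ltW.
- move=> /bnd D0; rewrite atanB_zero ?Dab ?D0 ?mul0r//.
  by rewrite mulrA mulVf ?mul1r// gt_eqF// pi_gt0.
Qed.
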